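(* There exists a computable tree $T \subseteq 2^{<\omega}$ such that $[T]$ is a perfect set and every perfect tree $P \subseteq T$ computes the halting problem $\emptyset'$.
   Context: A (binary) tree is a subset of $2^{<\omega}$ closed under initial segments; $[T] \subseteq 2^\omega$ is the set of infinite paths through $T$. A perfect set is a nonempty closed subset of $2^\omega$ without isolated points. A tree $P$ is perfect if it is nonempty and equals the set of all initial segments of members of a perfect set $C \subseteq 2^\omega$ (equivalently, every node of $P$ has two incomparable extensions in $P$). *)

(* Defs.v *)
From mathcomp Require Import all_boot.
From mathcomp Require Import all_classical.
From mathcomp Require Import topology cantor.
From Stdlib Require Cantor.

Set Implicit Arguments.
Unset Strict Implicit.
Unset Printing Implicit Defensive.

Local Open Scope classical_set_scope.

Notation npair x y := (Cantor.to_nat (x, y)) (only parsing).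

(* Indices of the unary partial functions on nat that are partial recursive in
   an oracle. Functions of several arguments are handled through Cantor's
   bijective pairing, and the identity is [Pair Fst Snd]. *)
Inductive index : Type :=
  | Zero
  | Succ
  | Fst
  | Snd
  | Oracle
  | Pair of index & index
  | Comp of index & index
  | Prec of index & index
  | Mu of index.

(* [eval A e x y] says that Phi_e^A(x) converges to y:
   - Oracle is the characteristic function of A;
   - Prec f g maps <x, 0> to f(x) and <x, n+1> to g(<x, <n, h(<x, n>)>>), where
     h = Prec f g, and it converges only if all these calls do;
   - Mu f maps x to the least y with f(<x, y>) = 0, and it converges only if
     f(<x, j>) converges for every j < y. *)
Fixpoint eval (A : set nat) (e : index) (x y : nat) : Prop :=
  match e with
  | Zero => y = 0
  | Succ => y = x.+1
  | Fst => y = (Cantor.of_nat x).1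
  | Snd => y = (Cantor.of_nat x).2
  | Oracle => y = (x \in A)
  | Pair f g => exists u v, [/\ eval A f x u, eval A g x v & y = npair u v]
  | Comp f g => exists2 z, eval A g x z & eval A f z y
  | Prec f g =>
      let a := (Cantor.of_nat x).1 in
      (fix rec (n y : nat) : Prop :=
         match n with
         | 0 => eval A f a y
         | m.+1 => exists2 z, rec m z & eval A g (npair a (npair m z)) y
         end) (Cantor.of_nat x).2 y
  | Mu f =>
      eval A f (npair x y) 0 /\
      forall j, j < y -> exists z, eval A f (npair x j) z.+1
  end.

Lemma eval_functional A e x y y' : eval A e x y -> eval A e x y' -> y = y'.
Proof.
elim: e x y y' => [||||| f IHf g IHg | f IHf g IHg | f IHf g IHg | f IHf]
  x y y' /=; try by move=> -> ->.
- move=> [u [v [fu gv ->]]] [u' [v' [fu' gv' ->]]].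
  by rewrite (IHf _ _ _ fu fu') (IHg _ _ _ gv gv').
- move=> [z gz fy] [z' gz' fy']; rewrite -(IHg _ _ _ gz gz') in fy'.
  exact: IHf fy fy'.
- elim: (Cantor.of_nat x).2 y y' => [|m IHm] y y'; first exact: IHf.
  move=> [z hz gy] [z' hz' gy']; rewrite -(IHm _ _ hz hz') in gy'.
  exact: IHg gy gy'.
- move=> [f0 ltf] [f0' ltf']; case: (ltngtP y y') => // lty.
  + by have [z fz] := ltf' _ lty; have := IHf _ _ _ f0 fz.
  + by have [z fz] := ltf _ lty; have := IHf _ _ _ f0' fz.
Qed.

Fixpoint godel (e : index) : nat :=
  match e with
  | Zero => npair 0 0
  | Succ => npair 1 0
  | Fst => npair 2 0
  | Snd => npair 3 0
  | Oracle => npair 4 0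
  | Pair f g => npair 5 (npair (godel f) (godel g))
  | Comp f g => npair 6 (npair (godel f) (godel g))
  | Prec f g => npair 7 (npair (godel f) (godel g))
  | Mu f => npair 8 (godel f)
  end.

Lemma godel_inj : injective godel.
Proof.
elim=> [||||| f IHf g IHg | f IHf g IHg | f IHf g IHg | f IHf]
  [||||| f' g' | f' g' | f' g' | f'] //;
  cbn [godel] => /(congr1 Cantor.of_nat); rewrite !Cantor.cancel_of_to //.
1-3: move=> /(congr1 (fun p => Cantor.of_nat p.2)).
1-3: by rewrite !Cantor.cancel_of_to => -[/IHf-> /IHg->].
by move=> [/IHf->].
Qed.

Definition turing_le (B A : set nat) : Prop :=
  exists e, forall n, eval A e n (n \in B).

Definition computable (B : set nat) : Prop := turing_le B set0.

(* The Turing jump A' = {e | Phi_e^A(e) converges}; a number that is not the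
   Goedel number of an index is not in A'. *)
Definition jump (A : set nat) : set nat :=
  [set n | exists2 e, godel e = n & exists y, eval A e n y].

Definition halting_problem : set nat := jump set0.

(* The rank of a binary string in the length-lexicographic order *)
Definition string_code (s : seq bool) : nat :=
  foldl (fun n (b : bool) => n.*2 + b + 1) 0 s.

Lemma string_code_inj : injective string_code.
Proof.
have E s b : string_code (rcons s b) = (string_code s).*2 + b + 1.
  by rewrite /string_code -cats1 foldl_cat.
elim/last_ind=> [|s b IH]; elim/last_ind=> [|t c _] //; rewrite ?E ?addn1 //.
move=> [eqst].
have bc : b = c.
  by have := congr1 odd eqst; rewrite !oddD !odd_double; case: b c {eqst} => -[].
by move: eqst; rewrite bc => /addIn /double_inj /IH ->.
Qed.

Definition set_code (S : set (seq bool)) : set nat := string_code @` S.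

Definition is_tree (T : set (seq bool)) : Prop :=
  forall s t, prefix s t -> T t -> T s.

Definition computable_tree (T : set (seq bool)) : Prop :=
  is_tree T /\ computable (set_code T).

Definition paths (T : set (seq bool)) : set cantor_space :=
  [set x | forall n, T (mkseq x n)].

Definition initial_segments (C : set cantor_space) : set (seq bool) :=
  [set s | exists2 x, C x & exists n, s = mkseq x n].

(* The library's [perfect_set] (closed and equal to its set of limit points)
   also holds of the empty set. *)
Definition nonempty_perfect (C : set cantor_space) : Prop :=
  C !=set0 /\ perfect_set C.

Definition perfect_tree (P : set (seq bool)) : Prop :=
  [/\ is_tree P, P !=set0 &
      exists2 C, nonempty_perfect C & P = initial_segments C].

(* Main.v *)
Require Import Defs.
From mathcomp Require Import all_boot.
From mathcomp Require Import all_classical.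
From mathcomp Require Import topology cantor.

Set Implicit Arguments.
Unset Strict Implicit.
Unset Printing Implicit Defensive.

Local Open Scope classical_set_scope.

(** Let [K n s] say that the program [n] halts within [s] steps: a decidable
    relation, monotone in [s], and [n] is in the halting problem iff some [K n s]
    holds ([halting_problemP]).

    A path can be read as a sequence of guesses: the position of its one number
    [n] (counting from 0) claims to bound the halting time of program [n]. The
    tree [settling_tree K] consists of the strings none of whose guesses has been
    refuted so far: if [n] is seen to halt by the stage that is the code of the
    string, then it was already seen to halt by the code of the prefix that ends
    at the one number [n]. Stages grow along a string, so this is a tree, and
    the condition on a string is decidable ([computable_settling_tree]).

    Its paths are the sequences all of whose guesses are correct
    ([path_settling_treeP]). They form a perfect set: after any finite part of
    a path one may either write only zeros, or write one further one, provided
    that it comes late enough to be a correct guess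
    ([perfect_paths_settling_tree]).

    A nonempty perfect set of paths has members with arbitrarily many ones,
    since two distinct members that agree up to some position have a one
    after it in one of them ([perfect_many_ones]). So if [P] is a perfect subtree,
    then for each [n] a search through [P] finds a node with more than [n] ones.
    This node lies on a path of the tree, so its guess for [n] is correct, and
    [n] halts iff it halts within as many steps as the code of that node
    ([settled_along_path]). This decides the halting problem from [P].

    The relation [K] comes from a machine with a stack of pending tasks that
    interprets indices. One step of it is a finite case distinction, whence the
    computability of [K]. *)

(** * Functions computable in an oracle *)

Definition pr x y := Cantor.to_nat (x, y).
Definition pr1 n := (Cantor.of_nat n).1.
Definition pr2 n := (Cantor.of_nat n).2.

Lemma pr1K x y : pr1 (pr x y) = x.
Proof. by rewrite /pr1 /pr Cantor.cancel_of_to. Qed.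

Lemma pr2K x y : pr2 (pr x y) = y.
Proof. by rewrite /pr2 /pr Cantor.cancel_of_to. Qed.

Lemma prK n : pr (pr1 n) (pr2 n) = n.
Proof. by rewrite /pr /pr1 /pr2 -surjective_pairing Cantor.cancel_to_of. Qed.

Definition prE := (pr1K, pr2K).

Arguments pr : simpl never.
Arguments pr1 : simpl never.
Arguments pr2 : simpl never.

(** Functions of several arguments are curried at the meta level: [g x y] counts
    as computable when [fun z => g (pr1 z) (pr2 z)] is, and predicates are
    functions through the coercion of booleans to 0 and 1. *)
Definition computable_fun (A : set nat) (f : nat -> nat) : Prop :=
  exists e, forall x, Defs.eval A e x (f x).

Section Combinators.

Context {A : set nat}.
Local Notation rec := (computable_fun A).

Lemma rec_ext f g : rec f -> f =1 g -> rec g.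
Proof. by move=> [e ef] fg; exists e => x; rewrite -fg. Qed.

Lemma rec_id : rec (fun x => x).
Proof.
exists (Pair Fst Snd) => x /=.
by exists (pr1 x), (pr2 x); split=> //; rewrite -[LHS]prK.
Qed.

Lemma rec_const c : rec (fun=> c).
Proof.
elim: c => [|c [e ec]]; first by exists Zero.
by exists (Comp Succ e) => x; exists c.
Qed.

Lemma rec_comp f g : rec f -> rec g -> rec (fun x => f (g x)).
Proof. by move=> [e ef] [d dg]; exists (Comp e d) => x; exists (g x). Qed.

Lemma rec_succ f : rec f -> rec (fun x => (f x).+1).
Proof. by apply: rec_comp; exists Succ. Qed.

Lemma rec_pr1 f : rec f -> rec (fun x => pr1 (f x)).
Proof. by apply: rec_comp; exists Fst. Qed.

Lemma rec_pr2 f : rec f -> rec (fun x => pr2 (f x)).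
Proof. by apply: rec_comp; exists Snd. Qed.

Lemma rec_oracle f : rec f -> rec (fun x => f x \in A).
Proof. by apply: (@rec_comp (fun n => n \in A)); exists Oracle. Qed.

Lemma rec_pr f g : rec f -> rec g -> rec (fun x => pr (f x) (g x)).
Proof.
by move=> [e ef] [d dg]; exists (Pair e d) => x; exists (f x), (g x).
Qed.

Lemma rec_comp2 (F : nat -> nat -> nat) f g :
  rec (fun z => F (pr1 z) (pr2 z)) -> rec f -> rec g ->
  rec (fun x => F (f x) (g x)).
Proof.
move=> rF rf rg; apply: rec_ext (rec_comp rF (rec_pr rf rg)) _ => x /=.
by rewrite !prE.
Qed.

Lemma rec_prec f g n :
  rec f -> rec (fun z => g (pr1 z) (pr1 (pr2 z)) (pr2 (pr2 z))) -> rec n ->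
  rec (fun x => nat_rec (fun=> nat) (f x) (g x) (n x)).
Proof.
move=> [e ef] [d dg] /(rec_pr rec_id) [c cn].
exists (Comp (Prec e d) c) => x; exists (pr x (n x)); first exact: cn.
rewrite /= -/(pr1 _) -/(pr2 _) !prE.
elim: (n x) => [|m IHm]; first exact: ef.
exists (nat_rec (fun=> nat) (f x) (g x) m) => //.
by have := dg (pr x (pr m (nat_rec (fun=> nat) (f x) (g x) m))); rewrite /= !prE.
Qed.

Lemma rec_iter g f n :
  rec f -> rec (fun z => g (pr1 z) (pr2 z)) -> rec n ->
  rec (fun x => iter (n x) (g x) (f x)).
Proof.
move=> rf rg rn.
apply: rec_ext (rec_prec (g := fun x _ => g x) rf _ rn) _.
  by apply: rec_comp2 rg _ _; [apply: rec_pr1 rec_id | apply/rec_pr2/rec_pr2/rec_id].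
by move=> x; elim: (n x) => //= m ->.
Qed.

Lemma rec_if (b : nat -> bool) f g :
  rec b -> rec f -> rec g -> rec (fun x => if b x then f x else g x).
Proof.
move=> rb rf rg.
apply: rec_ext (rec_prec (g := fun x _ _ => f x) rg _ rb) _.
  exact: rec_comp rf (rec_pr1 rec_id).
by move=> x; case: (b x).
Qed.

Lemma rec_pred f : rec f -> rec (fun x => (f x).-1).
Proof.
apply: (@rec_comp predn).
apply: rec_ext (rec_prec (g := fun _ m _ => m) (rec_const 0) _ rec_id) _.
  exact: rec_pr1 (rec_pr2 rec_id).
by case.
Qed.

Lemma rec_add f g : rec f -> rec g -> rec (fun x => f x + g x).
Proof.
move=> rf rg; apply: rec_ext (rec_iter (g := fun=> succn) rf _ rg) _.
  exact: rec_succ (rec_pr2 rec_id).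
by move=> x; rewrite iter_succn.
Qed.

Lemma rec_sub f g : rec f -> rec g -> rec (fun x => f x - g x).
Proof.
move=> rf rg; apply: rec_ext (rec_iter (g := fun=> predn) rf _ rg) _.
  exact: rec_pred (rec_pr2 rec_id).
by move=> x; elim: (g x) => [|m /= ->]; rewrite ?subn0 // subnS.
Qed.

Lemma rec_neg (b : nat -> bool) : rec b -> rec (fun x => ~~ b x).
Proof.
move=> rb; apply: rec_ext (rec_if rb (rec_const 0) (rec_const 1)) _.
by move=> x; case: (b x).
Qed.

Lemma rec_and (b c : nat -> bool) : rec b -> rec c -> rec (fun x => b x && c x).
Proof.
move=> rb rc; apply: rec_ext (rec_if rb rc (rec_const 0)) _.
by move=> x; case: (b x).
Qed.

Lemma rec_leq f g : rec f -> rec g -> rec (fun x => f x <= g x).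
Proof.
move=> rf rg.
have r := rec_prec (g := fun _ _ _ => 0) (rec_const 1) (rec_const 0) (rec_sub rf rg).
by apply: rec_ext r _ => x; rewrite /leq; case: (f x - g x).
Qed.

Lemma rec_eq f g : rec f -> rec g -> rec (fun x => f x == g x).
Proof.
move=> rf rg; apply: rec_ext (rec_and (rec_leq rf rg) (rec_leq rg rf)) _ => x.
by rewrite eqn_leq.
Qed.

Lemma rec_count (p : nat -> pred nat) n :
  rec (fun z => p (pr1 z) (pr2 z)) -> rec n ->
  rec (fun x => count (p x) (iota 0 (n x))).
Proof.
move=> rp rn.
apply: rec_ext (rec_prec (g := fun x m k => k + p x m) (rec_const 0) _ rn) _.
  apply: rec_add; first exact: rec_pr2 (rec_pr2 rec_id).
  by apply: (rec_comp2 (F := p)) => //; [apply: rec_pr1 rec_id | apply/rec_pr1/rec_pr2/rec_id].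
move=> x; elim: (n x) => // m IHm.
by rewrite -[in RHS]addn1 iotaD count_cat -IHm /= addn0.
Qed.

Lemma rec_search (p : nat -> pred nat) :
  rec (fun z => p (pr1 z) (pr2 z)) -> (forall x, exists y, p x y) ->
  exists2 f, rec f & forall x, p x (f x).
Proof.
move=> /rec_neg[e ep] expx; exists (fun x => ex_minn (expx x)).
  exists (Mu e) => x; case: ex_minnP => y pxy ymin; split=> [|j ltjy].
    by have := ep (pr x y); rewrite /= !prE pxy.
  have := ep (pr x j); rewrite /= !prE; case: (boolP (p x j)) => [/ymin|_].
    by rewrite leqNgt ltjy.
  by exists 0.
by move=> x; case: ex_minnP.
Qed.

End Combinators.

(* The combinator is chosen by the syntax of the body, since higher-order
   unification also has degenerate solutions. *)
Ltac prove_rec := cbv beta; lazymatch goal with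
  | |- computable_fun _ (fun x => x) => exact: rec_id
  | |- computable_fun _ (fun _ => ?c) => exact: rec_const
  | |- computable_fun _ pr1 => exact: (rec_pr1 rec_id)
  | |- computable_fun _ pr2 => exact: (rec_pr2 rec_id)
  | |- computable_fun _ (fun x => pr1 (@?f x)) =>
      simple refine (@rec_pr1 _ f _); prove_rec
  | |- computable_fun _ (fun x => pr2 (@?f x)) =>
      simple refine (@rec_pr2 _ f _); prove_rec
  | |- computable_fun _ (fun x => pr (@?f x) (@?g x)) =>
      simple refine (@rec_pr _ f g _ _); prove_rec
  | |- computable_fun _ (fun x => S (@?f x)) =>
      simple refine (@rec_succ _ f _); prove_rec
  | |- computable_fun _ (fun x => predn (@?f x)) =>
      simple refine (@rec_pred _ f _); prove_rec
  | |- computable_fun _ (fun x => nat_of_bool (@?f x == @?g x)) =>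
      simple refine (@rec_eq _ f g _ _); prove_rec
  | |- computable_fun _ (fun x => nat_of_bool (@?f x <= @?g x)) =>
      simple refine (@rec_leq _ f g _ _); prove_rec
  | |- computable_fun _
         (fun x => match @?b x with true => @?f x | false => @?g x end) =>
      simple refine (@rec_if _ b f g _ _ _); prove_rec
  | _ => try assumption
  end.

Lemma rec_odd A f : computable_fun A f -> computable_fun A (fun x => odd (f x)).
Proof.
apply: (@rec_comp _ odd).
have r : computable_fun A (fun n => iter n (fun b => 1 - b) 0).
  apply: (@rec_iter _ (fun _ b => 1 - b)); [exact: rec_const| |exact: rec_id].
  by apply: rec_sub; prove_rec.
by apply: rec_ext r _; elim=> //= n ->; case: (odd n).
Qed.

Lemma rec_half A f : computable_fun A f -> computable_fun A (fun x => (f x)./2).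
Proof.
(* half of n is the number of odd numbers below n *)
apply: (@rec_comp _ half).
apply: rec_ext (rec_count (p := fun=> odd) _ rec_id) _.
  by apply: rec_odd; prove_rec.
elim=> // n IHn; rewrite -[in LHS]addn1 iotaD count_cat IHn /= addn0.
by rewrite uphalf_half addnC.
Qed.

(** * A machine that interprets indices *)

Lemma eval_prec0 A f g a y :
  Defs.eval A (Prec f g) (pr a 0) y <-> Defs.eval A f a y.
Proof. by cbn [Defs.eval]; rewrite -/(pr1 _) -/(pr2 _) !prE. Qed.

Lemma eval_precS A f g a n y :
  Defs.eval A (Prec f g) (pr a n.+1) y <->
  exists2 z, Defs.eval A (Prec f g) (pr a n) z
    & Defs.eval A g (pr a (pr n z)) y.
Proof. by cbn [Defs.eval]; rewrite -!/(pr1 _) -!/(pr2 _) !prE. Qed.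

Lemma godelE :
  (godel Zero = pr 0 0) * (godel Succ = pr 1 0) * (godel Fst = pr 2 0) *
  (godel Snd = pr 3 0) * (godel Oracle = pr 4 0) *
  (forall f g, godel (Pair f g) = pr 5 (pr (godel f) (godel g))) *
  (forall f g, godel (Comp f g) = pr 6 (pr (godel f) (godel g))) *
  (forall f g, godel (Prec f g) = pr 7 (pr (godel f) (godel g))) *
  (forall f, godel (Mu f) = pr 8 (godel f)).
Proof. by []. Qed.

(* From here on only the projection and reconstruction equations of pairing
   matter; unfolding it on numerals would be ruinous. *)
Global Opaque pr pr1 pr2.

(** The stack of tasks: 0 is the empty stack, so the successor keeps a nonempty
    one apart from it. *)
Definition push a k := (pr a k).+1.

(** A task acts on a current value. The Goedel number of an index is itself
    a task, replacing the value [x] by the result at [x]; it has a tag below 9.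
    The tasks with higher tags resume an interrupted evaluation, the current value
    being the result that was awaited:
    - [pair_right g x] goes on to evaluate the second component at [x],
    - [pair_done u] pairs it with the first result [u],
    - [prec_next g a m] performs stage [m] of a primitive recursion,
    - [mu_test f x j] tests the value at [(x, j)] in a search,
    - [check c] keeps the value, and never ends unless [c] is a Goedel number. *)
Local Notation pair_right g x := (pr 9 (pr g x)).
Local Notation pair_done u := (pr 10 u).
Local Notation prec_next g a m := (pr 11 (pr g (pr a m))).
Local Notation mu_test f x j := (pr 12 (pr f (pr x j))).
Local Notation check c := (pr 13 c).

(** The step for the task with tag [t] and argument [q] on top of the stack [k],
    with current value [v]; a state is a pair of a stack and a value. Invalid
    tasks are left in place, so that the machine loops on them. *)
Definition transition t q k v :=
  if t == 0 then pr k 0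
  else if t == 1 then pr k v.+1
  else if t == 2 then pr k (pr1 v)
  else if t == 3 then pr k (pr2 v)
  else if t == 4 then pr k 0
  else if t == 5 then pr (push (pr1 q) (push (pair_right (pr2 q) v) k)) v
  else if t == 6 then pr (push (pr2 q) (push (pr1 q) k)) v
  else if t == 7 then
    if pr2 v == 0 then pr (push (pr1 q) k) (pr1 v)
    else pr (push (pr 7 q) (push (prec_next (pr2 q) (pr1 v) (pr2 v).-1) k))
            (pr (pr1 v) (pr2 v).-1)
  else if t == 8 then pr (push q (push (mu_test q v 0) k)) (pr v 0)
  else if t == 9 then pr (push (pr1 q) (push (pair_done v) k)) (pr2 q)
  else if t == 10 then pr k (pr q v)
  else if t == 11 then
    pr (push (pr1 q) k) (pr (pr1 (pr2 q)) (pr (pr2 (pr2 q)) v))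
  else if t == 12 then
    if v == 0 then pr k (pr2 (pr2 q))
    else pr (push (pr1 q)
               (push (mu_test (pr1 q) (pr1 (pr2 q)) (pr2 (pr2 q)).+1) k))
            (pr (pr1 (pr2 q)) (pr2 (pr2 q)).+1)
  else if t == 13 then
    if pr1 q <= 4 then if pr2 q == 0 then pr k v else pr (push (check q) k) v
    else if pr1 q <= 7 then
      pr (push (check (pr1 (pr2 q))) (push (check (pr2 (pr2 q))) k)) v
    else if pr1 q == 8 then pr (push (check (pr2 q)) k) v
    else pr (push (check q) k) v
  else pr (push (pr t q) k) v.

Definition step z :=
  if pr1 z == 0 then z
  else let k := (pr1 z).-1 in
       transition (pr1 (pr1 k)) (pr2 (pr1 k)) (pr2 k) (pr2 z).

Lemma rec_transition A t q k v :
  computable_fun A t -> computable_fun A q -> computable_fun A k ->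
  computable_fun A v ->
  computable_fun A (fun x => transition (t x) (q x) (k x) (v x)).
Proof. by move=> rt rq rk rv; rewrite /transition /push; prove_rec. Qed.

Lemma rec_step A f : computable_fun A f -> computable_fun A (fun x => step (f x)).
Proof.
apply: rec_comp; apply: (@rec_if _ (fun z => pr1 z == 0)); first by prove_rec.
  exact: rec_id.
by apply: rec_transition; prove_rec.
Qed.

Lemma step_push t q k v : step (pr (push (pr t q) k) v) = transition t q k v.
Proof. by rewrite /step prE /= !prE. Qed.

Definition halts_within s z := pr1 (iter s step z) == 0.

Lemma step_halted z : pr1 z == 0 -> step z = z.
Proof. by rewrite /step => ->. Qed.

Lemma halts_withinW s t z : s <= t -> halts_within s z -> halts_within t z.
Proof.
move=> lest h; rewrite /halts_within -(subnK lest) iterD.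
by elim: (t - s) => // m IHm; rewrite iterS step_halted.
Qed.

Lemma halts_within_push s a k v :
  halts_within s (pr (push a k) v) ->
  exists2 s', s' < s & halts_within s' (step (pr (push a k) v)).
Proof.
case: s => [|s]; rewrite /halts_within ?iterSr /= ?prE // => h.
by exists s.
Qed.

Lemma halts_within_fix s a k v :
  step (pr (push a k) v) = pr (push a k) v -> ~ halts_within s (pr (push a k) v).
Proof.
move=> fix_step; rewrite /halts_within.
suff -> : iter s step (pr (push a k) v) = pr (push a k) v by rewrite prE.
by elim: s => //= s ->.
Qed.

Definition reaches z z' := exists s, iter s step z = z'.

Lemma reaches_step z z' : reaches (step z) z' -> reaches z z'.
Proof. by move=> [s <-]; exists s.+1; rewrite iterSr. Qed.

Lemma reaches_trans z1 z2 z3 : reaches z1 z2 -> reaches z2 z3 -> reaches z1 z3.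
Proof. by move=> [s <-] [t <-]; exists (t + s); rewrite iterD. Qed.

Ltac machine_step :=
  apply: reaches_step; rewrite ?godelE step_push /transition /= ?prE.

Lemma eval_reaches e x y k :
  Defs.eval set0 e x y -> reaches (pr (push (godel e) k) x) (pr k y).
Proof.
elim: e x y k => [||||| f IHf g IHg | f IHf g IHg | f IHf g IHg | f IHf] x y k.
1-5: cbn [Defs.eval] => ->; rewrite ?in_set0 -?/(pr1 _) -?/(pr2 _).
1-5: by machine_step; exists 0.
- move=> [u [v [fu gv ->]]]; machine_step.
  apply: reaches_trans (IHf _ _ _ fu) _; machine_step.
  apply: reaches_trans (IHg _ _ _ gv) _; machine_step.
  by exists 0.
- move=> [z gz fy]; machine_step.
  by apply: reaches_trans (IHg _ _ _ gz) _; exact: IHf.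
- rewrite -(prK x); move: (pr1 x) (pr2 x) => a n {x}.
  elim: n y k => [|n IHn] y k.
    by move=> /eval_prec0 fy; machine_step; apply: IHf.
  move=> /eval_precS[z hz gy]; machine_step.
  apply: reaches_trans (IHn _ _ hz) _; machine_step.
  exact: IHg.
- move=> [f0 ltf]; machine_step.
  have loop j : j <= y -> reaches
      (pr (push (godel f) (push (mu_test (godel f) x 0) k)) (pr x 0))
      (pr (push (godel f) (push (mu_test (godel f) x j) k)) (pr x j)).
    elim: j => [|j IHj] ltjy; first by exists 0.
    apply: reaches_trans (IHj (ltnW ltjy)) _.
    have [z fz] := ltf j ltjy.
    by apply: reaches_trans (IHf _ _ _ fz) _; machine_step; exists 0.
  apply: reaches_trans (loop y (leqnn y)) _.
  by apply: reaches_trans (IHf _ _ _ f0) _; machine_step; exists 0.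
Qed.

Ltac halting_step h s lt :=
  move: h => /halts_within_push[s lt];
  rewrite ?godelE step_push /transition /= ?prE => h.

(** Conversely, the machine can only get rid of an evaluation task by completing
    it, which leaves strictly fewer steps for the rest of the stack. The decrease
    is what makes an induction possible on the number of rounds of a search. *)
Lemma halts_eval e s x k :
  halts_within s (pr (push (godel e) k) x) ->
  exists y s', [/\ Defs.eval set0 e x y, s' < s & halts_within s' (pr k y)].
Proof.
elim: e s x k => [||||| f IHf g IHg | f IHf g IHg | f IHf g IHg | f IHf] s x k h.
1-5: halting_step h s1 lt1.
1: by exists 0, s1.
1: by exists x.+1, s1.
1: by exists (pr1 x), s1.
1: by exists (pr2 x), s1.
1: by exists 0, s1; rewrite /= in_set0.
- halting_step h s1 lt1.
  have {h}[u [s2 [fu lt2 h]]] := IHf _ _ _ h.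
  halting_step h s3 lt3.
  have {h}[v [s4 [gv lt4 h]]] := IHg _ _ _ h.
  halting_step h s5 lt5.
  exists (pr u v), s5; split=> //; first by exists u, v.
  exact: ltn_trans lt5 (ltn_trans lt4 (ltn_trans lt3 (ltn_trans lt2 lt1))).
- halting_step h s1 lt1.
  have {h}[z [s2 [gz lt2 h]]] := IHg _ _ _ h.
  have {h}[y [s3 [fy lt3 h]]] := IHf _ _ _ h.
  exists y, s3; split=> //; first by exists z.
  exact: ltn_trans lt3 (ltn_trans lt2 lt1).
- rewrite -(prK x) in h *; move: (pr1 x) (pr2 x) h => a n {x}.
  elim: n s k => [|n IHn] s k h.
    halting_step h s1 lt1.
    have {h}[y [s2 [fy lt2 h]]] := IHf _ _ _ h.
    exists y, s2; split=> //; first exact/eval_prec0.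
    exact: ltn_trans lt1.
  halting_step h s1 lt1.
  have {h}[z [s2 [hz lt2 h]]] := IHn _ _ h.
  halting_step h s3 lt3.
  have {h}[y [s4 [gy lt4 h]]] := IHg _ _ _ h.
  exists y, s4; split=> //; first by apply/eval_precS; exists z.
  exact: ltn_trans lt4 (ltn_trans lt3 (ltn_trans lt2 lt1)).
- halting_step h s1 lt1.
  have loop j : (forall i, i < j -> exists z, Defs.eval set0 f (pr x i) z.+1) ->
      halts_within s1
        (pr (push (godel f) (push (mu_test (godel f) x j) k)) (pr x j)) ->
      exists y s', [/\ Defs.eval set0 (Mu f) x y, s' < s1
        & halts_within s' (pr k y)].
    elim/ltn_ind: s1 j {lt1 h} => s1 IHs j ltf h.
    have {h}[v [s2 [fv lt2 h]]] := IHf _ _ _ h.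
    halting_step h s3 lt3.
    have lt31 := ltn_trans lt3 lt2.
    case: v fv h => [|v] fv /= h; first by exists j, s3.
    have [|y [s4 [fy lt4 {}h]]] := IHs _ lt31 j.+1 _ h.
      by move=> i; rewrite ltnS leq_eqVlt => /predU1P[->|/ltf//]; exists v.
    by exists y, s4; split=> //; exact: ltn_trans lt31.
  have [//|y [s2 [fy lt2 h2]]] := loop 0 _ h.
  by exists y, s2; split=> //; exact: ltn_trans lt1.
Qed.

Lemma check_reaches e k v : reaches (pr (push (check (godel e)) k) v) (pr k v).
Proof.
elim: e k => [||||| f IHf g IHg | f IHf g IHg | f IHf g IHg | f IHf] k.
1-5: by machine_step; exists 0.
1-3: by machine_step; exact: reaches_trans (IHf _) (IHg _).
by machine_step; exact: IHf.
Qed.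

(** Evaluating a wrongly coded task might still halt, when the wrong part is
    never visited (for instance the step function of a primitive recursion called
    at stage 0). Hence the separate check of the code. *)
Lemma halts_check s c k v :
  halts_within s (pr (push (check c) k) v) ->
  exists e s', [/\ godel e = c, s' < s & halts_within s' (pr k v)].
Proof.
elim/ltn_ind: s c k v => s IHs c k v /halts_within_push[s1 lt1].
have := @halts_within_fix s1 (check c) k v.
rewrite step_push /transition /= -(prK c); move: (pr1 c) (pr2 c) => t q.
rewrite !prE.
case: leqP => [t4|t4].
  case: eqP => [-> _ h|_ loop]; last by move=> /(loop erefl).
  case: t t4 => [|[|[|[|[|//]]]]] _.
  - by exists Zero, s1; rewrite godelE.
  - by exists Succ, s1; rewrite godelE.
  - by exists Fst, s1; rewrite godelE.
  - by exists Snd, s1; rewrite godelE.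
  - by exists Oracle, s1; rewrite godelE.
case: leqP => [t7|t7].
  move=> _ /(IHs _ lt1)[f [s2 [fq lt2]]].
  have lt2s := ltn_trans lt2 lt1.
  move=> /(IHs _ lt2s)[g [s3 [gq lt3]]] h; have lt3s := ltn_trans lt3 lt2s.
  rewrite -(prK q) -fq -gq.
  case: t t4 t7 => [|[|[|[|[|[|[|[|//]]]]]]]] // _ _.
  - by exists (Pair f g), s3; rewrite godelE.
  - by exists (Comp f g), s3; rewrite godelE.
  - by exists (Prec f g), s3; rewrite godelE.
case: eqP => [->|_] loop; last by move=> /(loop erefl).
move=> /(IHs _ lt1)[f [s2 [<- lt2 h]]].
by exists (Mu f), s2; rewrite godelE; split=> //; exact: ltn_trans lt1.
Qed.

Definition start n := pr (push (check n) (push n 0)) n.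
Definition halts_by n s := halts_within s (start n).

Definition monotone_stages (K : nat -> nat -> bool) :=
  forall n s t, s <= t -> K n s -> K n t.

Lemma halts_by_mono : monotone_stages halts_by.
Proof. by move=> n s t; apply: halts_withinW. Qed.

Lemma halting_problemP n : halting_problem n <-> exists s, halts_by n s.
Proof.
split=> [[e <- [y ey]]|[s] /halts_check[e [s1 [<- _ h]]]].
  have [s run] := reaches_trans (check_reaches e _ _) (eval_reaches 0 ey).
  by exists s; rewrite /halts_by /halts_within run prE.
have [y [_ [ey _ _]]] := halts_eval h.
by exists e => //; exists y.
Qed.

Lemma rec_halts_by A n s :
  computable_fun A n -> computable_fun A s ->
  computable_fun A (fun x => halts_by (n x) (s x)).
Proof.
move=> rn rs; rewrite /halts_by /halts_within.
apply: rec_eq (rec_const 0); apply: rec_pr1.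
apply: (@rec_iter _ (fun=> step)) => //; last by apply/rec_step; prove_rec.
by rewrite /start /push; prove_rec.
Qed.

(** * Codes of strings *)

Lemma string_code_rcons s b :
  string_code (rcons s b) = (string_code s).*2 + b + 1.
Proof. by rewrite /string_code -cats1 foldl_cat. Qed.

Lemma leq_size_string_code s : size s <= string_code s.
Proof.
elim/last_ind: s => // s b IHs; rewrite size_rcons string_code_rcons addn1 ltnS.
by rewrite (leq_trans IHs) // -addnn -addnA leq_addr.
Qed.

Lemma leq_string_code s t : prefix s t -> string_code s <= string_code t.
Proof.
move=> /prefixP[u ->]; elim/last_ind: u => [|u b IHu]; first by rewrite cats0.
rewrite -rcons_cat string_code_rcons (leq_trans IHu) //.
by rewrite -addnn -!addnA leq_addr.
Qed.

Lemma string_code_surj n : exists s, string_code s = n.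
Proof.
elim/ltn_ind: n => -[|n] IHn; first by exists [::].
have [|s eqs] := IHn n./2; first by rewrite ltnS leq_half_double -addnn -addnS leq_addr.
exists (rcons s (odd n)).
by rewrite string_code_rcons eqs addn1 addnC odd_double_half.
Qed.

(** A last bit [b] contributes [b + 1] to twice the code of the rest, so removing
    and reading it are halving and parity on codes. The empty string, with code
    0, is its own parent and has no last one. *)
Definition parent c := c.-1./2.
Definition last_one c := (0 < c) && ~~ odd c.

Lemma parent_rcons s b : parent (string_code (rcons s b)) = string_code s.
Proof. by rewrite string_code_rcons addn1 /parent /= addnC half_bit_double. Qed.

Lemma last_one_rcons s b : last_one (string_code (rcons s b)) = b.
Proof.
by rewrite string_code_rcons addn1 /last_one /= negbK oddD odd_double oddb.
Qed.

Lemma iter_parent i s :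
  iter i parent (string_code s) = string_code (take (size s - i) s).
Proof.
elim: i => [|i IHi]; first by rewrite subn0 take_size.
rewrite iterS IHi subnS; case eqk : (size s - i) => [|k]; first by rewrite take0.
rewrite (take_nth false) ?parent_rcons //.
by rewrite (leq_trans _ (leq_subr i (size s))) // eqk.
Qed.

(** The bound [c] is at least the length of the string with code [c], and the
    iterates of [parent] beyond that length are 0, hence do not count. *)
Definition ones c := count (fun i => last_one (iter i parent c)) (iota 0 c).

Lemma ones_string_code s : ones (string_code s) = count id s.
Proof.
rewrite /ones; move: (leq_size_string_code s); move: {1 3}(string_code s) => n.
elim/last_ind: s n => [|s b IHs] n.
  move=> _; rewrite (@eq_count _ _ pred0) ?count_pred0 // => i /=.
  by rewrite iter_parent.
rewrite size_rcons; case: n => // n /IHs{}IHs.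
rewrite -cats1 count_cat /= addn0 addnC cats1 last_one_rcons; congr (_ + _).
rewrite -[1]addn0 iotaDl count_map -IHs; apply: eq_count => i.
by rewrite /= -iterS iterSr parent_rcons.
Qed.

Lemma rec_parent A f :
  computable_fun A f -> computable_fun A (fun x => parent (f x)).
Proof. by move=> rf; apply/rec_half/rec_pred. Qed.

Lemma rec_last_one A f :
  computable_fun A f -> computable_fun A (fun x => last_one (f x)).
Proof.
move=> rf; apply: (@rec_and _ (fun x => 0 < f x)); first by prove_rec.
exact/rec_neg/rec_odd.
Qed.

Lemma rec_iter_parent A i f : computable_fun A i -> computable_fun A f ->
  computable_fun A (fun x => iter (i x) parent (f x)).
Proof.
move=> ri rf; apply: (@rec_iter _ (fun=> parent)) => //.
by apply: rec_parent; prove_rec.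
Qed.

Lemma rec_ones A f : computable_fun A f -> computable_fun A (fun x => ones (f x)).
Proof.
apply: (@rec_comp _ ones); apply: rec_count rec_id.
by apply/rec_last_one/rec_iter_parent; prove_rec.
Qed.

(** * The settling tree *)

(** The code of the string, rather than its length, serves as the stage up to
    which a guess is tested; this only changes how soon a wrong guess is
    discovered. *)
Definition settling_tree (K : nat -> nat -> bool) : set (seq bool) :=
  [set s | forall t, prefix (rcons t true) s ->
     K (count id t) (string_code s) ->
     K (count id t) (string_code (rcons t true))].

Lemma settling_tree_is_tree K : monotone_stages K -> is_tree (settling_tree K).
Proof.
move=> K_mono s t st Tt u us Ku.
exact: Tt (prefix_trans us st) (K_mono _ _ _ (leq_string_code st) Ku).
Qed.

Definition violation (K : nat -> nat -> bool) c i :=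
  let d := iter i parent c in
  last_one d && (K (ones (parent d)) c && ~~ K (ones (parent d)) d).

Lemma violationP K s :
  reflect (settling_tree K s)
    (count (violation K (string_code s)) (iota 0 (string_code s)) == 0).
Proof.
rewrite -leqn0 leqNgt -has_count; apply: (iffP hasPn) => [ok t pre Kt|Ts i _].
  have lt_ts := size_prefix pre; rewrite size_rcons in lt_ts.
  have /ok : size s - (size t).+1 \in iota 0 (string_code s).
    rewrite mem_iota add0n /= (leq_trans _ (leq_size_string_code s)) //.
    by rewrite ltn_subrL (leq_trans _ lt_ts).
  rewrite /violation iter_parent subKn // -(size_rcons t true).
  have /eqP -> : take (size (rcons t true)) s == rcons t true by rewrite -prefixE.
  by rewrite last_one_rcons parent_rcons ones_string_code Kt negbK.
rewrite /violation iter_parent; have := prefix_take s (size s - i).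
move: (take _ _) => u; case/lastP: u => [|t b] //.
rewrite last_one_rcons parent_rcons ones_string_code.
by case: b => // /Ts; case: (K _ _) => // ->.
Qed.

Lemma computable_settling_tree (K : nat -> nat -> bool) :
  computable_fun set0 (fun z => K (pr1 z) (pr2 z)) ->
  computable (set_code (settling_tree K)).
Proof.
move=> rK.
suff : computable_fun set0 (fun c => count (violation K c) (iota 0 c) == 0).
  move=> r; apply: rec_ext r _ => c; congr nat_of_bool.
  have [s <-] := string_code_surj c.
  apply/violationP/idP => [Ts|]; first by rewrite inE; exists s.
  by rewrite inE => -[t Tt /string_code_inj <-].
apply: rec_eq (rec_const 0); apply: rec_count rec_id.
have rd : computable_fun set0 (fun z => iter (pr2 z) parent (pr1 z)).
  by apply: rec_iter_parent; prove_rec.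
have rn := rec_ones (rec_parent rd).
apply: rec_and; first exact: rec_last_one.
apply: rec_and; first by apply: (rec_comp2 (F := K)) => //; prove_rec.
by apply: rec_neg; apply: (rec_comp2 (F := K)).
Qed.

(** * Perfect sets of sequences *)

Lemma mkseqS (X : nat -> bool) n : mkseq X n.+1 = rcons (mkseq X n) (X n).
Proof. by rewrite /mkseq -addn1 iotaD map_cat cats1. Qed.

Lemma eq_mkseqP (X Y : nat -> bool) n :
  (mkseq X n = mkseq Y n) <-> (forall i, i < n -> X i = Y i).
Proof.
split=> [eqXY i ltin|eqXY]; last first.
  by apply/eq_in_map => i; rewrite mem_iota => /eqXY.
by rewrite -(nth_mkseq false X ltin) eqXY nth_mkseq.
Qed.

Lemma take_mkseq (X : nat -> bool) m n : m <= n -> take m (mkseq X n) = mkseq X m.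
Proof. by move=> lemn; rewrite /mkseq -map_take take_iota (minn_idPl lemn). Qed.

Lemma prefix_mkseq (X : nat -> bool) m n :
  m <= n -> prefix (mkseq X m) (mkseq X n).
Proof. by move=> lemn; rewrite prefixE size_mkseq take_mkseq. Qed.

Lemma nbhs_cylinder (X : cantor_space) (U : set cantor_space) :
  nbhs X U <-> exists n, forall Y : cantor_space, mkseq Y n = mkseq X n -> U Y.
Proof.
pose B n : set cantor_space := [set Y : cantor_space | mkseq Y n = mkseq X n].
split; last first.
  move=> [n BU]; apply: filterS BU _.
  elim: n => [|n IHn]; first by apply: filterS filterT => Y _.
  have nX : nbhs X (fun Y : cantor_space => Y n = X n).
    exact: (@proj_continuous nat (fun=> bool) n X [set X n] (discrete_set1 _)).
  by near=> Y; rewrite !mkseqS; congr rcons; near: Y.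
(* The cylinders around X generate a filter; as it converges to X pointwise, it
   is finer than the neighbourhoods of X. *)
have filterB : ProperFilter (filter_from setT B).
  apply: filter_from_proper; last by move=> n _; exists X.
  apply: filter_from_filter; first by exists 0.
  move=> m n _ _; exists (maxn m n) => // Y /= /eq_mkseqP eqY.
  split; apply/eq_mkseqP => i lti; apply: eqY.
    by rewrite leq_max lti.
  by rewrite leq_max lti orbT.
have cvgB : {ptws, filter_from setT B --> X}.
  apply/(@pointwise_cvgP nat bool (filter_from setT B) X) => i V /nbhs_singleton VX.
  by exists i.+1 => // Y /eq_mkseqP /(_ i (ltnSn i)) /= ->.
by move=> /cvgB [n _ BU]; exists n.
Unshelve. all: by end_near.
Qed.

Lemma closed_paths (T : set (seq bool)) : closed (paths T).
Proof.
move=> X clX n.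
have [|Y [TY eqYX]] := clX [set Y : cantor_space | mkseq Y n = mkseq X n].
  by apply/nbhs_cylinder; exists n.
by rewrite -eqYX.
Qed.

Lemma limit_point_cylinder (C : set cantor_space) (X : cantor_space) :
  limit_point C X <->
  forall n, exists Y : cantor_space, [/\ Y != X, C Y & mkseq Y n = mkseq X n].
Proof.
split=> [limX n|limX U /nbhs_cylinder[n nU]].
  apply: (limX [set Y : cantor_space | mkseq Y n = mkseq X n]).
  by apply/nbhs_cylinder; exists n.
by have [Y [neYX CY /nU UY]] := limX n; exists Y.
Qed.

Lemma count_mkseqS (X : nat -> bool) n :
  count id (mkseq X n.+1) = count id (mkseq X n) + X n.
Proof. by rewrite mkseqS -cats1 count_cat /= addn0. Qed.

Lemma leq_count_mkseq (X : nat -> bool) m n :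
  m <= n -> count id (mkseq X m) <= count id (mkseq X n).
Proof.
move=> /subnK <-; elim: (n - m) => // k IHk.
by rewrite addSn count_mkseqS (leq_trans IHk) ?leq_addr.
Qed.

Lemma nth_one (X : nat -> bool) n m :
  n < count id (mkseq X m) ->
  exists p, [/\ p < m, X p & count id (mkseq X p) = n].
Proof.
elim: m => // m IHm; rewrite count_mkseqS.
have [/IHm[p [ltpm Xp eqn]] _|le_n] := ltnP n (count id (mkseq X m)).
  by exists p; split=> //; apply: leqW.
case Xm: (X m); last by rewrite addn0 ltnNge le_n.
rewrite addn1 ltnS => ge_n; exists m; split=> //.
by apply/eqP; rewrite eqn_leq le_n.
Qed.

(** A member with [k] ones up to [m] has another member that agrees with it up to
    [m]. Where the two differ, one of them has a further one. *)
Lemma perfect_many_ones (C : set cantor_space) k :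
  nonempty_perfect C -> exists X m, C X /\ k <= count id (mkseq X m).
Proof.
move=> [[X0 CX0] [_ limC]]; elim: k => [|k [X [m [CX lek]]]].
  by exists X0, 0.
have := CX; rewrite -{1}limC => /limit_point_cylinder/(_ m)[Y [neYX CY eqm]].
have [p neq_p] : exists p, Y p <> X p.
  by apply/existsNP => eqYX; case/eqP: neYX; apply/funext.
have lemp : m <= p.
  rewrite leqNgt; apply/negP => ltpm; apply: neq_p.
  by move: p ltpm; apply/eq_mkseqP.
have [Z [CZ Zp eqZ]] : exists Z : cantor_space,
    [/\ C Z, Z p & mkseq Z m = mkseq X m].
  case Xp: (X p); first by exists X.
  by exists Y; split=> //; move: neq_p; rewrite Xp; case: (Y p).
exists Z, p.+1; split=> //.
by rewrite count_mkseqS Zp addn1 ltnS (leq_trans lek) // -eqZ leq_count_mkseq.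
Qed.

(** * Paths through the settling tree *)

(** Every stage is eventually reached along a path, so that every wrong guess
    is refuted at some level. *)
Lemma path_settling_treeP K (X : cantor_space) :
  monotone_stages K ->
  paths (settling_tree K) X <->
  forall p s, X p -> K (count id (mkseq X p)) s ->
    K (count id (mkseq X p)) (string_code (mkseq X p.+1)).
Proof.
move=> K_mono; split=> [pathX p s Xp Ks|settled n t pre Kt].
  have eqp : mkseq X p.+1 = rcons (mkseq X p) true by rewrite mkseqS Xp.
  rewrite eqp; apply: (pathX (maxn s p.+1)).
    by rewrite -eqp prefix_mkseq // leq_maxr.
  apply: K_mono Ks; apply: leq_trans (leq_size_string_code _).
  by rewrite size_mkseq leq_maxl.
have lt_tn : size t < n by have := size_prefix pre; rewrite size_rcons size_mkseq.
move: pre; rewrite prefixE size_rcons take_mkseq // => /eqP eqX.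
move: (eqX); rewrite mkseqS => /rcons_inj[eqt Xt].
by have := settled (size t) _ Xt; rewrite eqt eqX; apply; exact: Kt.
Qed.

Lemma settled_along_path K (X : cantor_space) m n s :
  monotone_stages K -> paths (settling_tree K) X ->
  n < count id (mkseq X m) -> K n s -> K n (string_code (mkseq X m)).
Proof.
move=> K_mono /(path_settling_treeP _ K_mono) settled /nth_one[p [ltpm Xp <-]].
move=> /(settled _ _ Xp).
by apply: K_mono; apply/leq_string_code/prefix_mkseq.
Qed.

Lemma perfect_paths_settling_tree K :
  monotone_stages K -> nonempty_perfect (paths (settling_tree K)).
Proof.
move=> K_mono; split.
  by exists (fun=> false); apply/path_settling_treeP => // p s.
split; first exact: closed_paths.
apply/seteqP; split=> X.
  by move=> /subset_limit_point; apply: closed_paths.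
move=> pathX; apply/limit_point_cylinder => n.
set k := count id (mkseq X n).
have [w Kw] : exists w, forall s, K k s -> K k w.
  case: (pselect (exists s, K k s)) => [[w Kw]|noK]; first by exists w.
  by exists 0 => s Ks; case: noK; exists s.
pose q := maxn n w.
(* Both continuations of X up to n are paths: Y false has zeros only, and the
   additional one of Y true, at q, is a correct guess for k. They differ, so one
   of them is not X. *)
pose Y b : cantor_space := fun i => if i < n then X i else b && (i == q).
have eqY b m : m <= n -> mkseq (Y b) m = mkseq X m.
  by move=> lemn; apply/eq_mkseqP => i lti; rewrite /Y (leq_trans lti).
have pathY b : paths (settling_tree K) (Y b).
  apply/path_settling_treeP => // p s.
  have [ltpn|lenp] := ltnP p n.
    rewrite !eqY ?(ltnW ltpn) // /Y ltpn.
    by move/(path_settling_treeP _ K_mono): pathX; apply.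
  rewrite {1}/Y ltnNge lenp /= => /andP[_ /eqP eqp].
  have -> : count id (mkseq (Y b) p) = k.
    rewrite /k -(eqY b n) // -(subnK lenp) addnC /mkseq iotaD map_cat count_cat.
    rewrite -[RHS]addn0; congr (_ + _).
    apply/eqP; rewrite -leqn0 leqNgt -has_count; apply/hasPn => x /mapP[i].
    rewrite mem_iota add0n subnKC // => /andP[leni ltip] -> {x}.
    by rewrite /Y ltnNge leni /= -eqp ltn_eqF ?andbF.
  move=> /Kw; apply: K_mono; apply: leq_trans (leq_size_string_code _).
  by rewrite size_mkseq eqp leqW // leq_maxr.
have [b neYX] : exists b, Y b != X.
  exists (~~ X q); apply/eqP => /(congr1 (fun Z : cantor_space => Z q)).
  by rewrite /Y ltnNge leq_maxl /= eqxx andbT; case: (X q).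
by exists (Y b); split=> //; exact: eqY.
Qed.

Theorem proposition2p4 :
  exists T : set (seq bool),
    [/\ computable_tree T,
        nonempty_perfect (paths T) &
        forall P : set (seq bool),
          perfect_tree P -> P `<=` T -> turing_le halting_problem (set_code P)].
Proof.
exists (settling_tree halts_by); split.
- split; first exact: settling_tree_is_tree halts_by_mono.
  by apply: computable_settling_tree; apply: rec_halts_by; prove_rec.
- exact: perfect_paths_settling_tree halts_by_mono.
move=> P [_ _ [C perfC defP]] PT.
have CT : C `<=` paths (settling_tree halts_by).
  by move=> X CX n; apply: PT; rewrite defP; exists X => //; exists n.
pose found n c := (c \in set_code P) && (n < ones c).
have [||f rf foundf] := @rec_search (set_code P) found.
- apply: rec_and; first by apply: rec_oracle; prove_rec.
  apply: rec_leq; first by prove_rec.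
  by apply: rec_ones; prove_rec.
- move=> n; have [X [m [CX ltn]]] := perfect_many_ones n.+1 perfC.
  exists (string_code (mkseq X m)); rewrite /found ones_string_code ltn andbT inE.
  by exists (mkseq X m) => //; rewrite defP; exists X => //; exists m.
have [e ef] := rec_halts_by rec_id rf.
exists e => n; suff -> : (n \in halting_problem) = halts_by n (f n) by exact: ef.
have /andP[] := foundf n; rewrite inE => -[s Ps <-]; rewrite ones_string_code.
move: Ps; rewrite defP => -[X CX [m ->]] ltn.
apply/idP/idP => [|h]; last first.
  by rewrite inE; apply/halting_problemP; exists (string_code (mkseq X m)).
rewrite inE => /halting_problemP[t].
exact: settled_along_path halts_by_mono (CT _ CX) ltn.
Qed.
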